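(* Let $1\le r\le d-1$. Then $$(q-1)^{r(d-r-1)}J^{(a)}_{\overline H^{r\cdot\infty}_{\alpha_1,\dots,\alpha_d}}=\sum\Big[\chi_q\big(C_{i_1^{r+2},i_2^{r+2},\dots,i_r^d}\big)\cdot J^{(i_1^{r+2}+\dots+i_1^d+a_1,\ \dots,\ i_r^{r+2}+\dots+i_r^d+a_r,\ a_{r+1})}\cdot\prod_{k=r+2}^dJ^{(-i_1^k,\dots,-i_r^k,\ a_k)}\Big],$$ where the sum runs over all integers $0\le i_l^k\le q-2$ ($1\le l\le r$, $r+2\le k\le d$), and $$C_{i_1^{r+2},\dots,i_r^d}=(-1)^{r(d-r)+a_1+\dots+a_d}\prod_{1\le l\le r}(\alpha_l-\alpha_{r+1})^{i_l^{r+2}+\dots+i_l^d}\prod_{l,j=1,\ j\ne l}^{r+1}(\alpha_j-\alpha_l)^{a_j}\cdot\prod_{k=r+2}^d(-1)^{a_k}\Big[\prod_{j=1}^r(\alpha_j-\alpha_k)^{a_k-i_j^k}\Big]\in\mathbb F_q^\times.$$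
   Context: $q$ is a power of a prime $p$, $n\ge2$ with $n\mid q-1$; fix a prime $\mathfrak p'$ of $\mathbb Z[\epsilon_{q-1}]$ above $p$ with residue field $\mathbb F_q$; $\chi_q:\mathbb F_q^\times\to\mathbb Z[\epsilon_{q-1}]^\times$ is the Teichmüller character ($\chi_q(\lambda)\equiv\lambda$ mod $\mathfrak p'$, $\chi_q(\lambda)^{q-1}=1$), with $\chi_q^b(0)=0$ for all integers $b$. For $(b)=(b_1,\dots,b_m)\in\mathbb Z^m$, $J^{(b)}=(-1)^{m-1}\sum_{z\in\mathbb F_q^m,\ z_1+\dots+z_m+1=0}\chi_q^{b_1}(z_1)\cdots\chi_q^{b_m}(z_m)$. For $S\subseteq\mathbb F_q^d$ and $(a)\in\mathbb Z^d$, $J^{(a)}_S=\sum_{z\in S}\prod_{j}\chi_q^{a_j}(z_j)$. Let $\alpha_1=0,\alpha_2=1,\alpha_3,\dots,\alpha_d$ be distinct elements of $\mathbb F_q$, $p(x)=\prod_{i=1}^d(x-\alpha_i)$, and identify $\mathbb F_q[x]/(p(x))\cong\mathbb F_q^d$ via $v\mapsto(v(\alpha_1),\dots,v(\alpha_d))$. $\overline H^{r\cdot\infty}_{\alpha_1,\dots,\alpha_d}\subseteq\mathbb F_q^d$ is the set of classes of monic polynomials of degree $r$, i.e. $\{(v(\alpha_1),\dots,v(\alpha_d)): v\in\mathbb F_q[x] \text{ monic}, \deg v=r\}$. Here $a_i=n_i\frac{q-1}{n}$ with $0<n_i<n$, $f=\prod_i(x-\alpha_i)^{n_i}$ (these $J^{(a)}_{\overline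 H^{r\cdot\infty}}$ are the coefficients of $t^r$ in the $L$-series $L(\mathbb P^1_q,\chi_f,t)$ of the associated cyclic cover).
   Formalization: Two signs in C are corrected: (-1)^{a_k} is taken inside the bracket, once for each j=1..r (giving (-1)^{r a_k}), and (-1)^{r(d-r)} is taken out of χ_q as an integer sign; as printed the identity fails, e.g. for q=4, d=2, r=1, a=(1,1) (2 = -2). *)

(* Defs.v *)
From HB Require Import structures.
From mathcomp Require Import all_boot all_order all_algebra all_field.
From mathcomp Require Import boolp.

Set Implicit Arguments.
Unset Strict Implicit.
Unset Printing Implicit Defensive.

Import Order.TTheory GRing.Theory Num.Theory.
Local Open Scope ring_scope.

Definition in_Zadj (x : algC) : {pred algC} :=
  [pred y | `[< exists v : {poly int}, y = (map_poly intr v).[x] >]].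

Lemma in_Zadj_subring_closed (x : algC) : subring_closed (in_Zadj x).
Proof.
split=> [|_ _ /asboolP[u ->] /asboolP[v ->]|_ _ /asboolP[u ->] /asboolP[v ->]].
- by apply/asboolP; exists 1; rewrite rmorph1 hornerC.
- by apply/asboolP; exists (u - v); rewrite rmorphB hornerD hornerN.
- by apply/asboolP; exists (u * v); rewrite rmorphM hornerM.
Qed.

HB.instance Definition _ (x : algC) :=
  GRing.isSubringClosed.Build algC (in_Zadj x) (in_Zadj_subring_closed x).

(* The ring Z[x], as a subring of the algebraic complex numbers. *)
Record Zadj (x : algC) :=
  InZadj { Zadj_val :> algC; _ : Zadj_val \in in_Zadj x }.

HB.instance Definition _ (x : algC) := [isSub for @Zadj_val x].
HB.instance Definition _ (x : algC) := [Choice of Zadj x by <:].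
HB.instance Definition _ (x : algC) :=
  [SubChoice_isSubComNzRing of Zadj x by <:].

(* pi presents F as the residue field of P. *)
Definition residue_map (A : comNzRingType) (F : fieldType) (P : {pred A})
    (pi : A -> F) : Prop :=
  (forall x, (x \in P) = (pi x == 0)) /\ (forall y, exists x, pi x = y).

(* The values of chi are only constrained on nonzero arguments, as chi stands
   for a map F^* -> A^*; the condition pi (chi x) = x is the congruence
   chi x = x modulo ker pi. *)
Definition teichmuller (A : comNzRingType) (F : finFieldType)
    (pi : A -> F) (chi : F -> A) : Prop :=
  {in predC1 0 &, {morph chi : x y / x * y}} /\
  (forall x, x != 0 -> pi (chi x) = x /\ chi x ^+ #|F|.-1 = 1).

Section JacobiSums.
Variables (x : algC) (F : finFieldType) (chi : F -> Zadj x).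

(* chi^b, with value 0 at 0 for every b, including b = 0. *)
Definition chiX (b : int) (y : F) : algC :=
  if y == 0 then 0 else (chi y : algC) ^ b.

Definition jacobi (m : nat) (b : m.-tuple int) : algC :=
  (-1) ^+ m.-1 *
  \sum_(z : m.-tuple F | \sum_(j < m) tnth z j + 1 == 0)
     \prod_(j < m) chiX (tnth b j) (tnth z j).

Definition jacobi_set (d : nat) (S : {set d.-tuple F}) (a : d.-tuple int) :
    algC :=
  \sum_(z in S) \prod_(j < d) chiX (tnth a j) (tnth z j).

End JacobiSums.

(* The classes of the monic polynomials of degree r, where F[X]/(prod_i
   (X - alpha_i)) is identified with F^d by evaluation at the alpha_i. *)
Definition monic_classes (F : finFieldType) (d : nat) (alpha : d.-tuple F)
    (r : nat) : {set d.-tuple F} :=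
  [set [tuple (polyn v).[tnth alpha j] | j < d]
    | v : {poly_(r.+1) F} & (polyn v \is monic) && (size (polyn v) == r.+1)].

(* Positions in alpha and a are counted from 0: alpha`_l is alpha_(l+1) in the
   usual numbering from 1. Accordingly i (l, k) is the summation index i_l^k
   attached to positions l < r and r.+1 + k < d. *)
Definition sum_idx (q d r : nat) : finType :=
  {ffun 'I_r * 'I_(d - r.+1) -> 'I_(q - 1)}.

(* The factor (-1)^(a_k) stands under the product over j, so that it
   contributes (-1)^(r a_k): it comes from alpha_k - alpha_j being written as
   - (alpha_j - alpha_k), once for each j. The sign (-1)^(r (d - r)) coming from
   the normalisation of the Jacobi sums is not part of this element of F: it has
   to be taken in Z, since chi (-1) = 1 in characteristic 2. *)
Definition Cst (F : fieldType) (q d r : nat) (alpha : d.-tuple F)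
    (a : d.-tuple nat) (i : sum_idx q d r) : F :=
  (-1) ^+ (\sum_(j < d) tnth a j)%N
  * (\prod_(l < r) (alpha`_l - alpha`_r) ^+ (\sum_(k < d - r.+1) i (l, k))%N)
  * (\prod_(l < r.+1) \prod_(j < r.+1 | j != l)
       (alpha`_j - alpha`_l) ^+ (nth 0%N a j))
  * (\prod_(k < d - r.+1) \prod_(j < r)
       ((-1) ^+ nth 0%N a (r.+1 + k) *
        (alpha`_j - alpha`_(r.+1 + k)) ^
          ((nth 0%N a (r.+1 + k))%:Z - (i (j, k))%:Z))).

(* (i_1^(r+2) + ... + i_1^d + a_1, ..., i_r^(r+2) + ... + i_r^d + a_r, a_(r+1)) *)
Definition head_exps (q d r : nat) (a : d.-tuple nat) (i : sum_idx q d r) :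
    (r.+1).-tuple int :=
  [tuple of rcons
     [tuple ((\sum_(k < d - r.+1) i (l, k))%N%:Z + (nth 0%N a l)%:Z) | l < r]
     (nth 0%N a r)%:Z].

(* (- i_1^k, ..., - i_r^k, a_k) *)
Definition tail_exps (q d r : nat) (a : d.-tuple nat) (i : sum_idx q d r)
    (k : 'I_(d - r.+1)) : (r.+1).-tuple int :=
  [tuple of rcons [tuple - (i (l, k))%:Z | l < r]
     (nth 0%N a (r.+1 + k))%:Z].

(* Main.v *)
(* Lagrange interpolation at the first r + 1 nodes parametrizes the monic v of
   degree r by the solutions z of z_1 + ... + z_{r+1} + 1 = 0, with
   v(alpha_l) = - z_l prod_{j <> l} (alpha_l - alpha_j) for l <= r + 1. At every
   other node, eliminating z_{r+1} gives
     v(alpha_k) = - prod_{j <= r} (alpha_k - alpha_j) * - (1 + sum_{l <= r} u_l),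
     u_l = z_l (alpha_l - alpha_{r+1}) / (alpha_l - alpha_k),
   and chi^c (- (1 + sum_l u_l)) is expanded into Jacobi sums by Fourier
   inversion on F^* ^r. Summing over z afterwards turns the characters of the
   z_l into the remaining Jacobi sum. *)
Require Import Defs.
From mathcomp Require Import all_boot all_order all_algebra all_field.
From mathcomp Require Import ring.

Set Implicit Arguments.
Unset Strict Implicit.
Unset Printing Implicit Defensive.

Import Order.TTheory GRing.Theory Num.Theory.
Local Open Scope ring_scope.

(** * Tuples ending in a distinguished entry, and reindexing of iterated operations *)

Lemma tnth_rcons_widen (T : Type) r (s : r.-tuple T) x l :
  tnth [tuple of rcons s x] (widen_ord (leqnSn r) l) = tnth s l.
Proof. by rewrite !(tnth_nth x) /= nth_rcons size_tuple ltn_ord. Qed.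

Lemma tnth_rcons_max (T : Type) r (s : r.-tuple T) x :
  tnth [tuple of rcons s x] ord_max = x.
Proof. by rewrite (tnth_nth x) /= nth_rcons size_tuple ltnn eqxx. Qed.

Lemma big_ord_tail (R : Type) (idx : R) (op : Monoid.law idx) m d
    (G : nat -> R) : (m <= d)%N ->
  \big[op/idx]_(j < d) G j =
  op (\big[op/idx]_(j < m) G j) (\big[op/idx]_(k < d - m) G (m + k)%N).
Proof.
move=> md; rewrite -!(big_mkord xpredT) (big_cat_nat (leq0n m) md) /=.
congr (op _ _).
by rewrite -{1}[m]add0n big_addn big_mkord; apply: eq_bigr => k _; rewrite addnC.
Qed.

(** Distributing a product over k of sums over the i^k yields families of functions; this turns them
    into the two-variable indices of [sum_idx]. *)
Lemma big_ffun_curry (R : Type) (idx : R) (op : Monoid.com_law idx)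
    (A B C : finType) (G : {ffun B -> {ffun A -> C}} -> R) :
  \big[op/idx]_(g : {ffun B -> {ffun A -> C}}) G g =
  \big[op/idx]_(i : {ffun A * B -> C}) G [ffun b => [ffun a => i (a, b)]].
Proof.
rewrite (reindex (fun i : {ffun A * B -> C} => [ffun b => [ffun a => i (a, b)]])) //.
exists (fun g : {ffun B -> {ffun A -> C}} => [ffun ab => g ab.2 ab.1]) => i _.
  by apply/ffunP => -[a b]; rewrite !ffunE.
by apply/ffunP => b; apply/ffunP => a; rewrite !ffunE.
Qed.

(** * Lagrange interpolation of monic polynomials *)

Section Interpolation.
Variables (F : fieldType) (r : nat) (A : nat -> F).
Hypothesis A_inj : {in gtn r.+1 &, injective A}.

(** The Lagrange basis polynomial, left unnormalised: being monic, it gives [interp z] the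
    coefficient - sum_l z_l in degree r. *)
Definition node_poly (l : 'I_r.+1) : {poly F} :=
  \prod_(j < r.+1 | j != l) ('X - (A j)%:P).

(* The sign matches the condition z_1 + ... + z_m + 1 = 0 of the Jacobi sums. *)
Definition interp (z : r.+1.-tuple F) : {poly F} :=
  - \sum_l tnth z l *: node_poly l.

Lemma node_poly_monic l : node_poly l \is monic.
Proof. exact: monic_prod_XsubC. Qed.

Lemma size_node_poly l : size (node_poly l) = r.+1.
Proof.
rewrite /node_poly -big_filter; have [e _ _ [_ e_size]] := big_enumP.
by rewrite size_prod_XsubC e_size cardC1 card_ord.
Qed.

Lemma node_poly_eq0 (l j : 'I_r.+1) : j != l -> (node_poly l).[A j] = 0.
Proof.
by move=> jl; rewrite horner_prod (bigD1 j) //= hornerXsubC subrr mul0r.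
Qed.

Lemma node_poly_neq0 l : (node_poly l).[A l] != 0.
Proof.
rewrite horner_prod; apply/prodf_neq0 => j jl; rewrite hornerXsubC subr_eq0.
apply: contra_neq jl => /A_inj jl; apply/val_inj/esym/jl; exact: ltn_ord.
Qed.

Lemma interp_node z (l : 'I_r.+1) :
  (interp z).[A l] = - (tnth z l * (node_poly l).[A l]).
Proof.
rewrite hornerN horner_sum (bigD1 l) //= hornerZ big1 ?addr0 // => j jl.
by rewrite hornerZ node_poly_eq0 ?mulr0 // eq_sym.
Qed.

Lemma size_interp z : (size (interp z) <= r.+1)%N.
Proof.
rewrite size_polyN; apply: (leq_trans (size_sum _ _ _)).
apply/bigmax_leqP => l _; rewrite (leq_trans (size_scale_leq _ _)) //.
by rewrite size_node_poly.
Qed.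

Lemma coef_interp z : (interp z)`_r = - \sum_l tnth z l.
Proof.
rewrite coefN coef_sum; congr (- _); apply: eq_bigr => l _.
have /eqP := node_poly_monic l; rewrite lead_coefE size_node_poly /= => c.
by rewrite coefZ c mulr1.
Qed.

(** With z read off from the values of v at the nodes, v - [interp z] has r + 1 distinct roots but
    size at most r + 1, so it is 0. *)
Lemma interp_surj (v : {poly F}) : (size v <= r.+1)%N ->
  exists z, v = interp z.
Proof.
move=> sv; pose z := [tuple - (v.[A l] / (node_poly l).[A l]) | l < r.+1].
exists z; apply/eqP; rewrite -subr_eq0; apply: contraTT isT => vz.
have : (size [seq A l | l <- iota 0 r.+1] < size (v - interp z)%R)%N.
  apply: max_poly_roots => //.
    apply/allP => _ /mapP[l + ->]; rewrite mem_iota /= => lr.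
    apply/rootP; rewrite hornerD hornerN (interp_node z (Ordinal lr)).
    by rewrite tnth_mktuple mulNr divfK ?(node_poly_neq0 (Ordinal lr)) // opprK subrr.
  rewrite map_inj_in_uniq ?iota_uniq // => i j; rewrite !mem_iota /=.
  exact: A_inj.
rewrite size_map size_iota ltnNge (leq_trans (size_polyD _ _)) //.
by rewrite geq_max size_polyN sv size_interp.
Qed.

Lemma interp_monic z :
  (interp z \is monic) && (size (interp z) == r.+1) = (\sum_l tnth z l + 1 == 0).
Proof.
rewrite addr_eq0 -eqr_oppLR -coef_interp.
apply/andP/eqP => [[/eqP + /eqP sz]|c1]; first by rewrite lead_coefE sz.
have sz : size (interp z) = r.+1.
  apply/eqP; rewrite eqn_leq size_interp ltnNge; apply/negP => sz.
  by move/eqP: c1; rewrite nth_default // eq_sym oner_eq0.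
by rewrite monicE lead_coefE sz c1 !eqxx.
Qed.

Lemma interp_off_node z y : (forall l : 'I_r.+1, y != A l) ->
    \sum_l tnth z l + 1 = 0 ->
  (interp z).[y] = - (\prod_(j < r) (y - A j)) *
   - (1 + \sum_(l < r) tnth z (widen_ord (leqnSn r) l) *
        ((A l - A r) / (A l - y))).
Proof.
move=> yA z1; rewrite hornerN horner_sum mulrNN.
pose N := \prod_(j < r.+1) (y - A j).
have nodeE (l : 'I_r.+1) : (node_poly l).[y] = N / (y - A l).
  rewrite horner_prod /N [in RHS](bigD1 l) //= [RHS]mulrC mulKf ?subr_eq0 //.
  by apply: eq_bigr => j _; rewrite hornerXsubC.
have NE : N = (\prod_(j < r) (y - A j)) * (y - A r) by rewrite /N big_ord_recr.
have yr : y - A r != 0 by rewrite subr_eq0 (yA ord_max).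
apply: (mulIf yr); rewrite [RHS]mulrAC -NE.
have -> : - \sum_i (tnth z i *: node_poly i).[y] =
    - (N * \sum_i tnth z i / (y - A i)).
  rewrite big_distrr; congr (- _); apply: eq_bigr => l _.
  by rewrite hornerZ nodeE mulrCA.
rewrite mulNr -mulrA -mulrN; congr (N * _).
(* Once 1 is replaced by - sum_l z_l, both sides end in the same term - z_{r+1}; the remaining terms
   agree one by one. *)
have -> : 1 = - \sum_l tnth z l by apply/eqP; rewrite -addr_eq0 addrC z1.
rewrite !big_ord_recr /= opprD mulrDl divfK // opprD addrAC; congr (_ - _).
rewrite big_distrl -!sumrN -big_split /=; apply: eq_bigr => l _.
have yl : y - A l != 0 by rewrite subr_eq0 (yA (widen_ord (leqnSn r) l)).
have ly : A l - y != 0 by rewrite -opprB oppr_eq0.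
by field; rewrite ly yl.
Qed.

End Interpolation.

(** * Multiplicativity of the Teichmüller character *)

Section TeichmullerCharacter.
Variables (eps : algC) (F : finFieldType) (pi : {rmorphism Zadj eps -> F}).
Variable chi : F -> Zadj eps.
Hypothesis chi_teich : teichmuller pi chi.

Local Notation q1 := (#|F| - 1)%N.

Lemma card_pred_gt0 : (0 < q1)%N.
Proof. by rewrite subn_gt0 finNzRing_gt1. Qed.

Lemma teich_expr y : y != 0 -> chi y ^+ q1 = 1.
Proof. by move=> y0; rewrite subn1; have [_ /(_ y y0) []] := chi_teich. Qed.

(** Multiplicativity makes [chi 1] idempotent, so it equals its own (q-1)-th power, which is 1. *)
Lemma teich1 : chi 1 = 1.
Proof.
have [chiM _] := chi_teich; move: (teich_expr (oner_neq0 F)).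
have idem : chi 1 * chi 1 = chi 1 by rewrite -chiM ?inE ?oner_neq0 ?mul1r.
suff -> : chi 1 ^+ q1 = chi 1 by [].
by case: q1 card_pred_gt0 => // m _; elim: m => // m IH; rewrite exprS IH.
Qed.

Lemma teich_neq0 y : y != 0 -> (chi y : algC) != 0.
Proof.
move=> y0; have /(congr1 val) := teich_expr y0.
rewrite rmorphXn rmorph1 /= => h; apply: contra_eq_neq h => ->.
by rewrite expr0n eqn0Ngt card_pred_gt0 eq_sym oner_neq0.
Qed.

Lemma teichM y z : y != 0 -> z != 0 ->
  chi (y * z) = (chi y : algC) * (chi z : algC) :> algC.
Proof. by move=> y0 z0; have [-> //] := chi_teich. Qed.

Lemma teichX y n : y != 0 -> chi (y ^+ n) = (chi y : algC) ^+ n :> algC.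
Proof.
move=> y0; elim: n => [|n IH]; first by rewrite !expr0 teich1.
by rewrite !exprS teichM ?expf_neq0 // IH.
Qed.

Lemma teich_prod (I : finType) (Q : pred I) (f : I -> F) :
    (forall i, Q i -> f i != 0) ->
  chi (\prod_(i | Q i) f i) = \prod_(i | Q i) (chi (f i) : algC) :> algC.
Proof.
(* Nonvanishing of the partial products is carried through the induction, because [chi] is known to
   be multiplicative only away from 0. *)
move=> f0; suff [] : \prod_(i | Q i) f i != 0 /\
  chi (\prod_(i | Q i) f i) = \prod_(i | Q i) (chi (f i) : algC) :> algC by [].
apply: (big_rec2 (fun u v => u != 0 /\ (chi u : algC) = v)) => [|i y2 y1 Qi []].
  by rewrite oner_neq0 teich1.
by move=> u0 <-; rewrite mulf_neq0 ?f0 ?teichM ?f0.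
Qed.

(** * Powers of the character, orthogonality and Fourier inversion *)

Local Notation chiX := (chiX chi).

Lemma chiX0 b : chiX b 0 = 0. Proof. by rewrite /Defs.chiX eqxx. Qed.

Lemma chiX_nat (n : nat) y : y != 0 -> chiX n y = chi (y ^+ n).
Proof. by move=> y0; rewrite /Defs.chiX (negPf y0) teichX. Qed.

Lemma chiXM b y z : chiX b (y * z) = chiX b y * chiX b z.
Proof.
rewrite /Defs.chiX mulf_eq0; have [|y0] := eqVneq y 0; first by rewrite mul0r.
have [|z0] := eqVneq z 0; first by rewrite mulr0.
by rewrite /= teichM // expfzMl.
Qed.

Lemma chiXD b c y : chiX (b + c) y = chiX b y * chiX c y.
Proof.
rewrite /Defs.chiX; have [|y0] := eqVneq y 0; first by rewrite mul0r.
by rewrite expfzDr ?teich_neq0.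
Qed.

(** At y = 0 an empty index type would give 0 on the left and 1 on the right, whence the restriction
    to y <> 0. *)
Lemma chiX_sum (I : finType) (f : I -> nat) y : y != 0 ->
  chiX (\sum_i f i)%N y = \prod_i chiX (f i) y.
Proof.
move=> y0; rewrite chiX_nat // -prodrXr.
under [RHS]eq_bigr do rewrite chiX_nat //.
by rewrite teich_prod // => i _; rewrite expf_neq0.
Qed.

(** For z nonzero and distinct from u, this is a geometric sum in chi(u/z), a (q-1)-th root of
    unity. It differs from 1 because its residue u/z does. *)
Lemma chiX_orthogonality u z : u != 0 ->
  \sum_(i < q1) chiX i u * chiX (- i%:Z) z = if z == u then q1%:R else 0.
Proof.
move=> u0; have [->|z0] := eqVneq z 0.
  by rewrite eq_sym (negPf u0) big1 // => i _; rewrite chiX0 mulr0.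
have [->|zu] := eqVneq z u.
  rewrite -[in RHS](card_ord q1) -sumr_const; apply: eq_bigr => i _.
  by rewrite -chiXD subrr /Defs.chiX (negPf u0) expr0z.
set w := u / z; have w0 : w != 0 by rewrite mulf_neq0 ?invr_eq0.
have uE : u = w * z by rewrite divfK.
have [_ /(_ w w0) [pi_w _]] := chi_teich.
have /(congr1 val) chi_wq := teich_expr w0.
have termE (i : 'I_q1) : chiX i u * chiX (- i%:Z) z = (chi w : algC) ^+ i.
  rewrite uE chiXM -mulrA -chiXD subrr /Defs.chiX (negPf w0) (negPf z0).
  by rewrite expr0z mulr1.
under eq_bigr do rewrite termE.
have w1 : (chi w : algC) - 1 != 0.
  rewrite subr_eq0; apply: contra_neqN zu => /eqP w1.
  have /val_inj w1' : val (chi w) = val (1 : Zadj eps) by rewrite rmorph1.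
  by rewrite uE -pi_w w1' rmorph1 mul1r.
apply: (mulfI w1); rewrite -subrX1 mulr0.
by move: chi_wq; rewrite rmorphXn rmorph1 /= => ->; rewrite subrr.
Qed.

(** After exchanging sums, orthogonality in each of the first r coordinates forces z_l = u_l, and
    the linear constraint fixes the last one. The sign (-1)^r is the normalisation of a Jacobi sum
    in r + 1 variables. *)
Lemma jacobi_inversion r (u : 'I_r -> F) (c : int) : (forall l, u l != 0) ->
  \sum_(i : {ffun 'I_r -> 'I_q1})
     (\prod_(l < r) chiX (i l) (u l)) *
     jacobi chi [tuple of rcons [tuple - (i l)%:Z | l < r] c]
  = (-1) ^+ r * q1%:R ^+ r * chiX c (- (1 + \sum_l u l)).
Proof.
move=> u0; rewrite /jacobi /=.
under eq_bigr => i _.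
  rewrite mulrCA big_distrr /=.
  under eq_bigr => z _.
    rewrite big_ord_recr tnth_rcons_max mulrA -big_split /=.
    under eq_bigr do rewrite tnth_rcons_widen tnth_mktuple.
    over.
  over.
rewrite -big_distrr -mulrA; congr (_ * _) => /=.
rewrite exchange_big /=.
under eq_bigr => z _.
  rewrite -big_distrl /=.
  rewrite -(bigA_distr_bigA (fun l (i : 'I_q1) =>
    chiX i (u l) * chiX (- i%:Z) (tnth z (widen_ord (leqnSn r) l)))) /=.
  under eq_bigr do rewrite chiX_orthogonality //.
  over.
pose z0 := [tuple of rcons [tuple u l | l < r] (- (1 + \sum_l u l))].
have z0E l : tnth z0 (widen_ord (leqnSn r) l) = u l.
  by rewrite tnth_rcons_widen tnth_mktuple.
have z0m : tnth z0 ord_max = - (1 + \sum_l u l) by rewrite tnth_rcons_max.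
rewrite (bigD1 z0) /=; last first.
  rewrite big_ord_recr /= z0m (eq_bigr u) => [|l _]; last exact: z0E.
  by rewrite opprD addrCA subrr addr0 addNr.
(* Only z = z0 contributes: the other z differ from u before the last entry. *)
rewrite z0m (eq_bigr (fun=> q1%:R)) => [|l _]; last by rewrite z0E eqxx.
rewrite prodr_const card_ord [X in _ + X]big1 ?addr0 // => z /andP[/eqP zsum zz0].
suff [l zl] : exists l, tnth z (widen_ord (leqnSn r) l) != u l.
  by rewrite (bigD1 l) //= (negPf zl) !mul0r.
apply/existsP; rewrite -negb_forall; apply: contraNN zz0 => /forallP zu.
have {}zu l : tnth z (widen_ord (leqnSn r) l) = u l by apply/eqP.
apply/eqP/eq_from_tnth => l; case: (unliftP ord_max l) => [l'|] ->.
  have -> : lift ord_max l' = widen_ord (leqnSn r) l'.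
    by apply: val_inj; rewrite /= /bump leqNgt ltn_ord.
  by rewrite zu z0E.
rewrite z0m; move: zsum; rewrite big_ord_recr /= (eq_bigr u) // => /eqP.
by rewrite addrAC addr_eq0 addrC => /eqP ->; rewrite opprK.
Qed.

(** * Expansion of the sum over monic classes into Jacobi sums *)

Section Expansion.
Variables (d r : nat) (alpha : d.-tuple F) (a : d.-tuple nat).
Hypotheses (r_lt_d : (r < d)%N) (alpha_uniq : uniq alpha).

Local Notation A := (nth 0 alpha).
Local Notation tl k := (r.+1 + k)%N.

Lemma alpha_eq j l : (j < d)%N -> (l < d)%N -> (A j == A l) = (j == l).
Proof. by move=> jd ld; rewrite nth_uniq ?size_tuple. Qed.

Lemma alpha_inj : {in gtn r.+1 &, injective A}.
Proof.
move=> j l; rewrite !inE => jr lr /eqP.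
by rewrite alpha_eq ?(leq_trans jr) ?(leq_trans lr) // => /eqP.
Qed.

Lemma tail_lt (k : 'I_(d - r.+1)) : (tl k < d)%N.
Proof. by rewrite -ltn_subRL. Qed.

Lemma alpha_tail_neq (k : 'I_(d - r.+1)) l : (l <= r)%N -> A (tl k) != A l.
Proof.
move=> lr; rewrite alpha_eq ?tail_lt ?(leq_ltn_trans lr) // gtn_eqF //.
by rewrite (leq_ltn_trans lr) // ltnS leq_addr.
Qed.

Lemma jacobi_set_monic_classes (b : d.-tuple int) :
  jacobi_set chi (monic_classes alpha r) b =
  \sum_(z : r.+1.-tuple F | \sum_l tnth z l + 1 == 0)
     \prod_(j < d) chiX (tnth b j) (interp A z).[tnth alpha j].
Proof.
pose T (z : r.+1.-tuple F) := [tuple (interp A z).[tnth alpha j] | j < d].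
have -> : monic_classes alpha r =
    T @: [set z : r.+1.-tuple F | \sum_l tnth z l + 1 == 0].
  apply/setP => t; apply/imsetP/imsetP => -[].
    move=> v; rewrite inE => + ->; move: (valP v) => sv.
    have [z vz] := interp_surj alpha_inj sv; exists z; last first.
      by apply: eq_from_tnth => j; rewrite !tnth_mktuple vz.
    by rewrite inE -(interp_monic A) -vz.
  move=> z; rewrite inE -(interp_monic A) => z1 ->.
  by exists (NPoly (size_interp A z)); rewrite ?inE.
(* Injectivity of [T]: since r < d, the first r + 1 nodes are among the evaluation points, and the
   value at node l determines z_l. *)
rewrite /jacobi_set big_imset /=; last first.
  move=> z z' _ _ zz'; apply: eq_from_tnth => l.
  have ld : (l < d)%N by rewrite (leq_trans (ltn_ord l)).
  have := congr1 (fun t => tnth t (Ordinal ld)) zz'.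
  rewrite !tnth_mktuple (tnth_nth 0) /= !interp_node => /oppr_inj.
  by apply: mulIf; apply: (node_poly_neq0 alpha_inj).
rewrite (eq_bigl (fun z : r.+1.-tuple F => \sum_l tnth z l + 1 == 0)).
  by apply: eq_bigr => z _; apply: eq_bigr => j _; rewrite tnth_mktuple.
by move=> z; rewrite inE.
Qed.

(** Regroups the constant by node: the value of [interp z] at a head node is z_l times the first
    kind of factor, while each later node contributes its factor - prod_l (alpha_k - alpha_l) and
    the ratios occurring in u_l. *)
Lemma Cst_factor q (i : sum_idx q d r) :
  Cst alpha a i =
    (\prod_(l < r.+1) (- (node_poly A l).[A l]) ^+ nth 0%N a l) *
    \prod_(k < d - r.+1)
      ((- \prod_(l < r) (A (tl k) - A l)) ^+ nth 0%N a (tl k) *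
       \prod_(l < r) ((A l - A r) / (A l - A (tl k))) ^+ i (l, k)).
Proof.
rewrite /Cst.
have -> : (\sum_(j < d) tnth a j = \sum_(j < d) nth 0 a j)%N.
  by apply: eq_bigr => j _; rewrite (tnth_nth 0%N).
rewrite (big_ord_tail _ (nth 0%N a) r_lt_d) /= exprD -!prodrXr.
have -> : \prod_(l < r.+1) (- (node_poly A l).[A l]) ^+ nth 0%N a l =
    (\prod_(l < r.+1) (-1) ^+ nth 0%N a l) *
    \prod_(l < r.+1) \prod_(j < r.+1 | j != l) (A j - A l) ^+ nth 0%N a j.
  (* [Cst] attaches the exponent to j, whereas expanding the node values attaches it to l; swapping
     the two indices reconciles them. *)
  rewrite [in RHS](exchange_big_dep xpredT) //= -big_split /=.
  apply: eq_bigr => l _; rewrite [LHS]exprNn horner_prod -prodrXl; congr (_ * _).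
  under eq_bigr do rewrite hornerXsubC.
  by apply: eq_bigl => j; rewrite eq_sym.
under [X in _ * X * _ * _]eq_bigr do rewrite -prodrXr.
rewrite [X in _ * X * _ * _]exchange_big /=.
rewrite -!mulrA; congr (_ * _); rewrite mulrA mulrCA; congr (_ * _).
rewrite -!big_split /=; apply: eq_bigr => k _.
rewrite [in RHS]exprNn -!mulrA -!prodrXl; congr (_ * _); rewrite -!big_split /=.
apply: eq_bigr => l _; have lk := alpha_tail_neq k (ltnW (ltn_ord l)).
have lk0 : A l - A (tl k) != 0 by rewrite subr_eq0 eq_sym.
(* The integer exponent a_k - i may be negative, so it is split using that its base is nonzero. *)
rewrite expfzDr // -exprnN -exprnP expr_div_n -(opprB (A l)) [in RHS]exprNn.
ring.
Qed.

Lemma head_factor_neq0 (l : 'I_r.+1) : - (node_poly A l).[A l] != 0.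
Proof. by rewrite oppr_eq0 (node_poly_neq0 alpha_inj). Qed.

Lemma tail_factor_neq0 (k : 'I_(d - r.+1)) :
  - \prod_(l < r) (A (tl k) - A l) != 0.
Proof.
rewrite oppr_eq0; apply/prodf_neq0 => l _.
by rewrite subr_eq0 alpha_tail_neq // ltnW.
Qed.

Lemma ratio_neq0 (k : 'I_(d - r.+1)) (l : 'I_r) :
  (A l - A r) / (A l - A (tl k)) != 0.
Proof.
apply: mulf_neq0; rewrite ?invr_eq0 subr_eq0.
  by rewrite alpha_eq ?ltn_eqF // (ltn_trans (ltn_ord l)).
by rewrite eq_sym alpha_tail_neq // ltnW.
Qed.

Lemma Cst_neq0 q (i : sum_idx q d r) : Cst alpha a i != 0.
Proof.
rewrite Cst_factor; apply: mulf_neq0; apply/prodf_neq0.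
  by move=> l _; rewrite expf_neq0 ?head_factor_neq0.
move=> k _; rewrite mulf_neq0 ?expf_neq0 ?tail_factor_neq0 //.
by apply/prodf_neq0 => l _; rewrite expf_neq0 ?ratio_neq0.
Qed.

Lemma teich_Cst q (i : sum_idx q d r) :
  (chi (Cst alpha a i) : algC) =
    (\prod_(l < r.+1) chiX (nth 0%N a l) (- (node_poly A l).[A l])) *
    \prod_(k < d - r.+1)
      (chiX (nth 0%N a (tl k)) (- \prod_(l < r) (A (tl k) - A l)) *
       \prod_(l < r) chiX (i (l, k)) ((A l - A r) / (A l - A (tl k)))).
Proof.
have h0 (l : 'I_r.+1) : (- (node_poly A l).[A l]) ^+ nth 0%N a l != 0.
  by rewrite expf_neq0 ?head_factor_neq0.
have t0 (k : 'I_(d - r.+1)) :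
    (- \prod_(l < r) (A (tl k) - A l)) ^+ nth 0%N a (tl k) != 0.
  by rewrite expf_neq0 ?tail_factor_neq0.
have s0 (k : 'I_(d - r.+1)) (l : 'I_r) :
    ((A l - A r) / (A l - A (tl k))) ^+ i (l, k) != 0.
  by rewrite expf_neq0 ?ratio_neq0.
have ss0 (k : 'I_(d - r.+1)) :
    \prod_(l < r) ((A l - A r) / (A l - A (tl k))) ^+ i (l, k) != 0.
  by apply/prodf_neq0.
rewrite Cst_factor teichM; last 2 first.
- by apply/prodf_neq0.
- by apply/prodf_neq0 => k _; rewrite mulf_neq0.
rewrite !teich_prod // => [|k _]; last by rewrite mulf_neq0.
congr (_ * _).
  by apply: eq_bigr => l _; rewrite chiX_nat ?head_factor_neq0.
apply: eq_bigr => k _; rewrite teichM // chiX_nat ?tail_factor_neq0 //.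
rewrite teich_prod //; congr (_ * _).
by apply: eq_bigr => l _; rewrite chiX_nat ?ratio_neq0.
Qed.

(** The expansion for a single z, to be summed over z afterwards: only the characters of the z_l
    then depend on z, and they sum to the head Jacobi sum. *)
Lemma chiX_interp_expansion (z : r.+1.-tuple F) : \sum_l tnth z l + 1 = 0 ->
  q1%:R ^+ (r * (d - r.+1)) *
    \prod_(j < d) chiX (nth 0%N a j) (interp A z).[A j] =
  \sum_(i : sum_idx #|F| d r)
     (-1) ^+ (r * (d - r.+1)) * (chi (Cst alpha a i) : algC) *
     (\prod_(l < r.+1) chiX (tnth (head_exps a i) l) (tnth z l)) *
     \prod_(k < d - r.+1) jacobi chi (tail_exps a i k).
Proof.
move=> z1.
pose G j := chiX (nth 0%N a j) (interp A z).[A j].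
rewrite (big_ord_tail _ G r_lt_d) {}/G /=.
(* Inversion needs u_l <> 0; if some z_l with l <= r vanishes, both sides are 0,
   since chi^b(0) = 0 even for b = 0. *)
have [z_neq0|] := boolP [forall l : 'I_r, tnth z (widen_ord (leqnSn r) l) != 0];
    last first.
  rewrite negb_forall => /existsP[l /negPn/eqP zl].
  rewrite (bigD1 (widen_ord (leqnSn r) l)) //= (interp_node _ z (widen_ord _ l)) zl.
  rewrite mul0r oppr0 chiX0 !mul0r mulr0 big1 // => i _.
  by rewrite (bigD1 (widen_ord (leqnSn r) l)) //= zl chiX0 !mul0r mulr0 mul0r.
move/forallP in z_neq0.
pose u (k : 'I_(d - r.+1)) (l : 'I_r) := tnth z (widen_ord (leqnSn r) l) *
  ((A l - A r) / (A l - A (tl k))).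
have u_neq0 k l : u k l != 0 by rewrite mulf_neq0 ?ratio_neq0.
(* Each of the d - r - 1 later nodes uses up one factor (q-1)^r, the constant of its own
   inversion. *)
have -> : q1%:R ^+ (r * (d - r.+1)) = \prod_(k < d - r.+1) q1%:R ^+ r :> algC.
  by rewrite prodr_const card_ord exprM.
rewrite mulrCA -big_split /=.
under [X in _ * X]eq_bigr => k _.
  rewrite interp_off_node //; last first.
    by move=> l; rewrite alpha_tail_neq // -ltnS.
  rewrite chiXM mulrCA.
  have -> : q1%:R ^+ r * chiX (nth 0%N a (tl k)) (- (1 + \sum_l u k l)) =
      (-1) ^+ r * \sum_(i : {ffun 'I_r -> 'I_q1})
        (\prod_(l < r) chiX (i l) (u k l)) *
        jacobi chi [tuple of rcons [tuple - (i l)%:Z | l < r]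
                                   (nth 0%N a (tl k))%:Z].
    by rewrite jacobi_inversion // !mulrA -expr2 sqrr_sign mul1r.
  rewrite mulrA big_distrr /=.
  over.
rewrite bigA_distr_bigA /= big_ffun_curry /= big_distrr /=.
apply: eq_bigr => i _.
under [X in _ * X]eq_bigr => k _.
  have -> : [tuple of rcons
        [tuple - ([ffun k' => [ffun l => i (l, k')]] k l : 'I__)%:Z | l < r]
        (nth 0%N a (tl k))%:Z] = tail_exps a i k.
    by apply: val_inj => /=; congr rcons; apply: eq_map => l; rewrite !ffunE.
  under [X in _ * (X * _)]eq_bigr => l _ do rewrite !ffunE /u chiXM.
  rewrite big_split /=.
  over.
rewrite teich_Cst [X in _ = _ * X * _]big_ord_recr /= tnth_rcons_max.
under [X in _ = _ * (X * _) * _]eq_bigr => l _.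
  rewrite tnth_rcons_widen tnth_mktuple chiXD chiX_sum //.
  over.
under eq_bigr => l _ do rewrite interp_node -mulrN chiXM.
rewrite !big_split /= prodr_const card_ord -exprM.
(* On the right the ratios in [Cst] are grouped by k but the characters of z_l by l; one swap makes
   both sides match up to commutativity. *)
rewrite [X in _ = _ * (X * _ * _) * _]exchange_big /=.
rewrite [X in X * _ * _ = _]big_ord_recr /=.
ring.
Qed.

Lemma jacobi_set_expansion :
  q1%:R ^+ (r * (d - r - 1)) *
    jacobi_set chi (monic_classes alpha r) [tuple (tnth a j)%:Z | j < d] =
  \sum_(i : sum_idx #|F| d r)
     ((-1) ^+ (r * (d - r)) * (chi (Cst alpha a i) : algC) *
      jacobi chi (head_exps a i) *
      \prod_(k < d - r.+1) jacobi chi (tail_exps a i k)).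
Proof.
rewrite -subnDA addn1 jacobi_set_monic_classes big_distrr /=.
under eq_bigr => z /eqP z1.
  under eq_bigr do rewrite tnth_mktuple !(tnth_nth 0).
  rewrite chiX_interp_expansion //.
  over.
rewrite exchange_big /=; apply: eq_bigr => i _.
rewrite -big_distrl -big_distrr; congr (_ * _) => /=.
rewrite /jacobi mulrA; congr (_ * _) => /=.
(* Since d - r = (d - r - 1) + 1, the sign is that of the later nodes times (-1)^r, and the latter
   cancels the normalisation of the head Jacobi sum. *)
rewrite -(subnSK r_lt_d) mulnSr [RHS]mulrAC exprD.
by rewrite -(mulrA (_ ^+ (_ * _))) -expr2 sqrr_sign mulr1.
Qed.

End Expansion.
End TeichmullerCharacter.

Theorem theorem2
  (p e q n : nat) (F : finFieldType) (eps : algC)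
  (P : prime_idealr (Zadj eps)) (pi : {rmorphism Zadj eps -> F})
  (chi : F -> Zadj eps)
  (d r : nat) (alpha : d.-tuple F) (ns a : d.-tuple nat)
  (p_prime : prime p) (q_def : q = (p ^ e)%N) (cardF : #|F| = q)
  (n_ge2 : (2 <= n)%N) (n_dvd : (n %| q - 1)%N)
  (eps_prim : (q - 1).-primitive_root eps)
  (P_above : (p%:R : Zadj eps) \in (P : {pred Zadj eps}))
  (pi_res : residue_map P pi)
  (chi_teich : teichmuller pi chi)
  (alpha1 : alpha`_0 = 0) (alpha2 : alpha`_1 = 1) (alpha_uniq : uniq alpha)
  (ns_range : forall j : 'I_d, (0 < tnth ns j < n)%N)
  (a_def : forall j : 'I_d, tnth a j = (tnth ns j * ((q - 1) %/ n))%N)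
  (r_range : (1 <= r <= d - 1)%N) :
  (forall i : sum_idx q d r, Cst alpha a i != 0) /\
  ((q - 1)%N%:R ^+ (r * (d - r - 1)) *
     jacobi_set chi (monic_classes alpha r) [tuple (tnth a j)%:Z | j < d]
   = \sum_(i : sum_idx q d r)
       ((-1) ^+ (r * (d - r)) * (chi (Cst alpha a i) : algC)
        * jacobi chi (head_exps a i)
        * \prod_(k < d - r.+1) jacobi chi (tail_exps a i k))).
Proof.
have r_lt_d : (r < d)%N.
  (* The subtraction in d - 1 is truncated; 1 <= r excludes d = 0, so r <= d - 1 really gives r <
     d. *)
  case/andP: r_range => r0 rd; have := leq_trans r0 rd; rewrite subn_gt0 => d1.
  by rewrite (leq_ltn_trans rd) // ltn_subrL (ltnW d1).
clear q_def; subst q; split=> [i|]; first exact: Cst_neq0.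
exact: (jacobi_set_expansion chi_teich).
Qed.
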